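(* Let $H$ be a $k\times k$ matrix-weighted graph on $n$ vertices that is $\gamma$-almost regular. Then for any $\zeta\in(0,1)$, the number of eigenvalues of its normalized Laplacian $N$ that lie in $(0,\zeta]$ is at most $\frac{\gamma\cdot k^2}{(1-\zeta)^2}$.
   Context: A $k\times k$ matrix-weighted graph $H=(V,E)$ with $|V|=n$ assigns to each edge $(u,v)\in E$ a vector $\phi_{uv}\in\mathbb{R}^k$, meaning the edge has matrix weight $\phi_{uv}\phi_{uv}^T$. The generalized degree of $u$ is $D_u=\sum_{v:(u,v)\in E}\phi_{uv}\phi_{uv}^T\in\mathbb{R}^{k\times k}$, and $D\in\mathbb{R}^{nk\times nk}$ is block diagonal with diagonal blocks $D_u$. Fixing an arbitrary orientation of each edge $u\to v$, the incidence vector $b_{uv}\in\mathbb{R}^{nk}$ has $\phi_{uv}$ in block $u$, $-\phi_{uv}$ in block $v$, and zeros elsewhere; the Laplacian is $L=\sum_{(u,v)\in E}b_{uv}b_{uv}^T$ and the normalized Laplacian is $N=D^{\dagger/2}LD^{\dagger/2}$ ($\dagger$ = Moore–Penrose pseudoinverse). $H$ is $\gamma$-almost regular if $\phi_{uv}^TD_u^\dagger\phi_{uv}\le\frac{\gamma k}{n}$ for every vertex $u$ and every edge $(u,v)\in E$ incident on $u$. *)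

(* Defs.v *)
From HB Require Import structures.
From mathcomp Require Import all_boot all_order all_algebra.
From mathcomp Require Import boolp classical_sets reals.
From mathcomp Require Import polyrcf complex spectral sesquilinear.
From mathcomp Require Import ring lra.

Set Implicit Arguments.
Unset Strict Implicit.
Unset Printing Implicit Defensive.

Import Order.TTheory GRing.Theory Num.Theory.
Local Open Scope ring_scope.

Section MatrixNotions.
Variable R : realType.

(* The four Penrose equations. *)
Definition is_pseudoinverse m n (A : 'M[R]_(m, n)) (X : 'M[R]_(n, m)) : Prop :=
  [/\ A *m X *m A = A, X *m A *m X = X,
      (A *m X)^T = A *m X & (X *m A)^T = X *m A].

Definition pseudoinverse m n (A : 'M[R]_(m, n)) : 'M[R]_(n, m) :=
  xget 0 [set X | is_pseudoinverse A X]%classic.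

Definition psd n (A : 'M[R]_n) : Prop :=
  A^T = A /\ forall x : 'cV[R]_n, 0 <= (x^T *m A *m x) ord0 ord0.

Definition psd_sqrt n (A : 'M[R]_n) : 'M[R]_n :=
  xget 0 [set S | psd S /\ S *m S = A]%classic.

(* Number of eigenvalues of A in ]a, b], counted with algebraic multiplicity;
   rootsR lists each root once. *)
Definition num_eigenvalues_in n (A : 'M[R]_n) (a b : R) : nat :=
  (\sum_(x <- rootsR (char_poly A) | ((a < x) && (x <= b))%R)
    mup x (char_poly A))%N.

End MatrixNotions.

(* A finite simple graph on 'I_n; the vector of an edge does not depend on the
   order in which its endpoints are given, and values of edge_vec off the edge
   set are never used. *)
Record mwgraph (R : realType) (n k : nat) := MWGraph {
  edge : rel 'I_n;
  edge_vec : 'I_n -> 'I_n -> 'cV[R]_k;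
  edge_sym : symmetric edge;
  edge_irr : irreflexive edge;
  edge_vec_sym : forall u v, edge u v -> edge_vec u v = edge_vec v u
}.

Section MatrixWeightedGraph.
Variables (R : realType) (n k : nat) (H : mwgraph R n k).

Definition gen_degree (u : 'I_n) : 'M[R]_k :=
  \sum_(v < n | edge H u v) edge_vec H u v *m (edge_vec H u v)^T.

(* nk-dimensional objects are indexed by 'I_(\sum_(u < n) k), the index type of
   the library's block matrices with n blocks of size k. *)
Definition degree_mx : 'M[R]_(\sum_(u < n) k) :=
  \mxdiag_(u < n) gen_degree u.

Definition incidence (u v : 'I_n) : 'cV[R]_(\sum_(u < n) k) :=
  \mxcol_(w < n) (if w == u then edge_vec H u v
                  else if w == v then - edge_vec H u v else 0).

(* o u v means that the edge {u, v} is oriented u -> v. *)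
Definition is_orientation (o : rel 'I_n) : Prop :=
  forall u v, edge H u v -> o u v = ~~ o v u.

Definition laplacian (o : rel 'I_n) : 'M[R]_(\sum_(u < n) k) :=
  \sum_(u < n) \sum_(v < n | edge H u v && o u v)
    incidence u v *m (incidence u v)^T.

Definition normalized_laplacian (o : rel 'I_n) : 'M[R]_(\sum_(u < n) k) :=
  psd_sqrt (pseudoinverse degree_mx) *m laplacian o
    *m psd_sqrt (pseudoinverse degree_mx).

Definition almost_regular (gamma : R) : Prop :=
  forall u v, edge H u v ->
    ((edge_vec H u v)^T *m pseudoinverse (gen_degree u) *m edge_vec H u v)
      ord0 ord0 <= gamma * k%:R / n%:R.

End MatrixWeightedGraph.

(* pseudoinverse, psd_sqrt and num_eigenvalues_in are characterized below:
   existence and uniqueness make the default value 0 in xget irrelevant. *)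
Section Facts.
Variable R : realType.

Lemma is_pseudoinverse_uniq m n (A : 'M[R]_(m, n)) X Y :
  is_pseudoinverse A X -> is_pseudoinverse A Y -> X = Y.
Proof.
case=> AXA XAX sAX sXA [AYA YAY sAY sYA].
have eL : A *m X = A *m Y.
  by rewrite -{1}AYA -mulmxA -{1}sAX -sAY -trmx_mul mulmxA AXA sAY.
have eR : X *m A = Y *m A.
  by rewrite -{1}AYA !mulmxA -(mulmxA _ Y) -{1}sXA -sYA -trmx_mul -mulmxA
    (mulmxA A) AXA sYA.
by rewrite -XAX eR -mulmxA eL mulmxA YAY.
Qed.

Lemma gram_eq0 m n (A : 'M[R]_(m, n)) : A *m A^T = 0 -> A = 0.
Proof.
move=> A0; apply/matrixP => i j; rewrite mxE.
have /eqP := congr1 (fun M : 'M_m => M i i) A0.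
rewrite !mxE psumr_eq0 => [/allP/(_ j (mem_index_enum _))|l _]; rewrite !mxE.
  by rewrite -expr2 sqrf_eq0 => /eqP.
by rewrite -expr2 sqr_ge0.
Qed.

Lemma gram_unitmx m n (F : 'M[R]_(m, n)) : row_free F -> F *m F^T \in unitmx.
Proof.
move=> Ff; rewrite -row_free_unit -kermx_eq0; apply/eqP.
have K0 := mulmx_ker (F *m F^T); move: (kermx _) K0 => K K0.
have : (K *m F) *m (K *m F)^T = 0 by rewrite trmx_mul !mulmxA -(mulmxA K) K0 mul0mx.
by move/gram_eq0/eqP; rewrite mulmx_free_eq0 // => /eqP.
Qed.

Lemma pseudoinverse_exists m n (A : 'M[R]_(m, n)) :
  exists X, is_pseudoinverse A X.
Proof.
have FU := gram_unitmx (row_base_free A).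
have CU : (col_base A)^T *m col_base A \in unitmx.
  rewrite -{2}(trmxK (col_base A)); apply: gram_unitmx.
  by rewrite /row_free mxrank_tr; exact: col_base_full.
have AE := esym (mulmx_base A).
move: (col_base A) (row_base A) AE FU CU; move: (\rank A) => r C F AE FU CU.
pose P := invmx (F *m F^T); pose Q := invmx (C^T *m C).
have PT : P^T = P by rewrite /P trmx_inv trmx_mul trmxK.
have QT : Q^T = Q by rewrite /Q trmx_inv trmx_mul trmxK.
have eAX : A *m (F^T *m P *m Q *m C^T) = C *m Q *m C^T.
  by rewrite AE !mulmxA -(mulmxA C F) -(mulmxA C _ P) mulmxV // mulmx1.
have eXA : (F^T *m P *m Q *m C^T) *m A = F^T *m P *m F.
  by rewrite AE !mulmxA -(mulmxA _ C^T C) -(mulmxA _ Q) mulVmx // mulmx1.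
exists (F^T *m P *m Q *m C^T); split.
- by rewrite eAX AE !mulmxA -(mulmxA _ C^T C) -(mulmxA _ Q) mulVmx // mulmx1.
- by rewrite eXA !mulmxA -(mulmxA _ F F^T) -(mulmxA _ _ P) mulmxV // mulmx1.
- by rewrite eAX !trmx_mul trmxK QT mulmxA.
- by rewrite eXA !trmx_mul trmxK PT mulmxA.
Qed.

Lemma pseudoinverseP m n (A : 'M[R]_(m, n)) :
  is_pseudoinverse A (pseudoinverse A).
Proof. by have [X /xgetI] := pseudoinverse_exists A; apply. Qed.

Lemma psd_gram m n (B : 'M[R]_(m, n)) : psd (B *m B^T).
Proof.
split=> [|x]; first by rewrite trmx_mul trmxK.
rewrite mulmxA -mulmxA -[B in x^T *m B]trmxK -trmx_mul mxE.
by apply: sumr_ge0 => i _; rewrite !mxE -expr2 sqr_ge0.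
Qed.

Lemma quad_ge0 (a b : R) :
  0 <= b -> 0 <= a -> (forall t, 0 <= t * (2 * a + t * b)) -> a = 0.
Proof.
move=> b0 age0 H; have b1 : 0 < b + 1 by lra.
have := H (- a / (b + 1)).
have -> : - a / (b + 1) * (2 * a + - a / (b + 1) * b) =
    - (a ^+ 2 * (b + 2) / (b + 1) ^+ 2) by field; lra.
rewrite oppr_ge0 pmulr_lle0 ?invr_gt0 ?exprn_gt0 // pmulr_lle0; last by lra.
by move=> h; apply/eqP; rewrite -sqrf_eq0 eq_le h sqr_ge0.
Qed.

Lemma psd_ker n (S : 'M[R]_n) (x : 'cV_n) :
  psd S -> (x^T *m S *m x) ord0 ord0 = 0 -> S *m x = 0.
Proof.
move=> [sS Sge0] x0; pose y := S *m x.
pose a : R := (y^T *m y) ord0 ord0; pose b : R := (y^T *m S *m y) ord0 ord0.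
have H t : 0 <= t * (2 * a + t * b).
  have := Sge0 (x + t *: y).
  have -> : (x + t *: y)^T *m S *m (x + t *: y) =
    x^T *m S *m x + t *: (y^T *m y) + t *: (y^T *m y) + (t * t) *: (y^T *m S *m y).
    have -> : (x + t *: y)^T = x^T + t *: y^T by apply/matrixP => i j; rewrite !mxE.
    rewrite !(mulmxDl, mulmxDr) -!(scalemxAl, scalemxAr).
    rewrite -!mulmxA -/y scalerA !mulmxA.
    have -> : x^T *m S = y^T by rewrite /y trmx_mul sS.
    by rewrite !addrA.
  rewrite !mxE in x0 *; rewrite x0 -/a.
  have -> : \sum_j y^T ord0 j * y j ord0 = a by rewrite /a mxE.
  have -> : \sum_j (y^T *m S) ord0 j * y j ord0 = b by rewrite /b mxE.
  by lra.
have b0 : 0 <= b by exact: Sge0.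
have a0 : a = 0.
  apply: (quad_ge0 b0 _ H).
  by rewrite /a mxE sumr_ge0 // => i _; rewrite mxE -expr2 sqr_ge0.
apply: trmx_inj; rewrite trmx0; apply: gram_eq0; rewrite trmxK.
by apply/matrixP => i j; rewrite !ord1 [RHS]mxE.
Qed.

Lemma psd_sqrt_uniq n (S T : 'M[R]_n) :
  psd S -> psd T -> S *m S = T *m T -> S = T.
Proof.
move=> pS pT eST; apply/eqP; rewrite -subr_eq0; apply/eqP.
set d := S - T; have dT : d^T = d.
  by rewrite /d linearB /= (proj1 pS) (proj1 pT).
have h0 : S *m d + d *m T = 0.
  by rewrite /d mulmxBr mulmxBl eST addrA subrK subrr.
have ge P i : psd P -> 0 <= (d *m P *m d) i i.
  case=> _ /(_ (col i d)); congr (_ <= _).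
  rewrite tr_col dT -row_mul; rewrite [in LHS]mxE [in RHS]mxE.
  by apply: eq_bigr => j _; rewrite !mxE.
have t0 : \tr (d *m S *m d) + \tr (d *m T *m d) = 0.
  rewrite -mulmxA [X in _ + X]mxtrace_mulC mulmxA [X in _ + X]mxtrace_mulC.
  rewrite [X in _ + X]mxtrace_mulC -mulmxA -linearD /= -mulmxDr h0.
  by rewrite mulmx0 linear0.
have trge P : psd P -> 0 <= \tr (d *m P *m d).
  by move=> pP; apply: sumr_ge0 => i _; exact: ge.
have kill P : psd P -> \tr (d *m P *m d) = 0 -> P *m d = 0.
  move=> pP /eqP; rewrite psumr_eq0 => [/allP z|i _]; last exact: ge.
  apply/matrixP => i j.
  have /matrixP/(_ i ord0) : P *m col j d = 0.
    apply: psd_ker => //; have /eqP <- := z j (mem_index_enum _).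
    rewrite tr_col dT -row_mul; rewrite [in LHS]mxE [in RHS]mxE.
    by apply: eq_bigr => l _; rewrite !mxE.
  by rewrite !mxE => h; rewrite -[RHS]h; apply: eq_bigr => l _; rewrite !mxE.
have trS := trge _ pS; have trT := trge _ pT.
have Sd : S *m d = 0 by apply: kill => //; lra.
have Td : T *m d = 0 by apply: kill => //; lra.
by apply: gram_eq0; rewrite dT {1}/d mulmxBl Sd Td subrr.
Qed.

Lemma interpolation (f : R -> R) (s : seq R) :
  exists q : {poly R}, forall x, x \in s -> q.[x] = f x.
Proof.
elim: s => [|x s [q qf]]; first by exists 0.
have [xs|xs] := boolP (x \in s).
  by exists q => y; rewrite inE => /orP[/eqP ->|]; exact: qf.
pose p := \prod_(y <- s) ('X - y%:P).
have px : p.[x] != 0 by rewrite -[_ == _]/(root p x) root_prod_XsubC.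
exists (q + ((f x - q.[x]) / p.[x]) *: p) => y; rewrite inE hornerD hornerZ.
case/orP => [/eqP ->|ys]; first by rewrite divfK // addrC subrK.
have /eqP -> : root p y by rewrite root_prod_XsubC.
by rewrite mulr0 addr0 qf.
Qed.

Local Notation toC := (real_complex R).

Lemma psd_sqrt_exists n (A : 'M[R]_n) :
  psd A -> exists S, psd S /\ S *m S = A.
Proof.
case: n A => [|n] A [sA Age0].
  by exists A; split => //; apply/matrixP => -[].
pose AC := map_mx toC A.
have conjr x : Num.conj (toC x) = toC x by apply/CrealP/complex_realP; exists x.
have hA : AC \is hermsymmx.
  apply/is_hermitianmxP; rewrite expr0 scale1r; apply/matrixP => i j.
  by rewrite !mxE conjr -[in LHS]sA mxE.
have /hermitian_normalmx/orthomx_spectralP := hA.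
have /mxOverP := hermitian_spectral_diag_real hA.
have := spectral_unitarymx AC.
move: (spectralmx AC) (spectral_diag AC) => U d UU dreal ACE.
have Uu := unitarymx_unit UU.
have rowA i : row i U *m AC = d ord0 i *: row i U.
  rewrite -row_mul ACE -!mulmxA mulKVmx // row_mul row_diag_mx.
  by rewrite -scalemxAl -rowE.
pose r i := complex.Re (d ord0 i).
have dE i : d ord0 i = toC (r i).
  by have /complex_realP[y dy] := dreal ord0 i; rewrite /r dy.
have r_ge0 i : 0 <= r i.
  have : eigenvalue AC (toC (r i)).
    apply/eigenvalueP; exists (row i U); first by rewrite rowA dE.
    apply/negP => /eqP Ui0; have := congr1 (mulmx^~ (invmx U)) Ui0.
    rewrite -row_mul mulmxV // mul0mx => /matrixP/(_ ord0 i).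
    by rewrite !mxE eqxx => /eqP; rewrite oner_eq0.
  rewrite eigenvalue_root_char -map_char_poly fmorph_root.
  rewrite -eigenvalue_root_char => /eigenvalueP[v vA v0].
  have := Age0 v^T; rewrite trmxK vA -scalemxAl mxE.
  have vv : 0 <= (v *m v^T) ord0 ord0.
    by rewrite mxE sumr_ge0 // => j _; rewrite mxE -expr2 sqr_ge0.
  have vvn : (v *m v^T) ord0 ord0 != 0.
    apply: contra v0 => /eqP z; apply/eqP/gram_eq0.
    by apply/matrixP => a b; rewrite !ord1 z mxE.
  by rewrite pmulr_lge0 // lt_def vvn.
have [q qE] := interpolation (fun x => Num.sqrt (Num.sqrt x)) (codom r).
pose B := horner_mx A q.
have BT : B^T = B.
  rewrite /B; elim/poly_ind: (q) => [|p c IH]; first by rewrite rmorph0 trmx0.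
  rewrite rmorphD rmorphM /= horner_mx_X horner_mx_C linearD /= tr_scalar_mx.
  rewrite trmx_mul IH sA; congr (_ + _).
  by apply: comm_mx_horner.
have rowp i p : row i U *m horner_mx AC p = p.[d ord0 i] *: row i U.
  elim/poly_ind: p => [|p c IH]; first by rewrite rmorph0 mulmx0 horner0 scale0r.
  rewrite rmorphD rmorphM /= horner_mx_X horner_mx_C mulmxDr mulmxA IH.
  by rewrite -scalemxAl rowA scalerA mul_mx_scalar -scalerDl !hornerE.
have p0 : horner_mx A (q ^+ 4 - 'X) = 0.
  apply: (@map_mx_inj _ _ toC); rewrite map_horner_mx map_mx0 -/AC.
  rewrite -[LHS](mulKmx Uu); rewrite -[RHS](mulmx0 _ (invmx U)).
  congr (_ *m _); apply/row_matrixP => i.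
  rewrite row_mul rowp row0 dE horner_map /= hornerD hornerN hornerX horner_exp.
  rewrite qE ?codom_f // (exprM _ 2 2) !sqr_sqrtr ?sqrtr_ge0 //.
  by rewrite subrr rmorph0 scale0r.
exists (B *m B); split; first by rewrite -{2}BT; exact: psd_gram.
apply/eqP; rewrite -subr_eq0; apply/eqP; rewrite -[RHS]p0.
by rewrite rmorphB rmorphXn /= horner_mx_X -/B (exprM _ 2 2) !expr2.
Qed.

Lemma psd_sqrtP n (A : 'M[R]_n) :
  psd A -> psd (psd_sqrt A) /\ psd_sqrt A *m psd_sqrt A = A.
Proof.
by move=> /psd_sqrt_exists[S hS];
  exact: (@xgetI _ 0 [set T | psd T /\ T *m T = A]%classic S hS).
Qed.

Lemma psd_pseudoinverse n (A : 'M[R]_n) : psd A -> psd (pseudoinverse A).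
Proof.
move=> [sA Age0]; have pX := pseudoinverseP A; set X := pseudoinverse A in pX *.
have XT : X^T = X.
  apply: (is_pseudoinverse_uniq _ pX); case: pX => AXA XAX sAX sXA; split.
  - by apply: trmx_inj; rewrite !trmx_mul trmxK sA mulmxA AXA.
  - by apply: trmx_inj; rewrite !trmx_mul !trmxK sA mulmxA XAX.
  - by rewrite trmx_mul trmxK sA -sXA trmx_mul sA.
  - by rewrite trmx_mul trmxK sA -sAX trmx_mul sA.
split=> // x; case: pX => _ <- _ _.
have := Age0 (X *m x).
by rewrite trmx_mul XT !mulmxA.
Qed.

Lemma num_eigenvalues_inE n (A : 'M[R]_n) (s : seq R) a b :
  char_poly A = \prod_(x <- s) ('X - x%:P) ->
  num_eigenvalues_in A a b = count (fun x => (a < x) && (x <= b)) s.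
Proof.
rewrite /num_eigenvalues_in => ->; set p := \prod_(x <- s) _.
have p0 : p != 0 by rewrite monic_neq0 // monic_prod_XsubC.
have ur : uniq (rootsR p) by exact: uniq_roots.
have pE x : (x \in rootsR p) = (x \in s).
  by rewrite -roots_on_rootsR // inE /= root_prod_XsubC.
rewrite (perm_big (undup s)) /=; last first.
  by apply: uniq_perm => // [|x]; rewrite ?undup_uniq // mem_undup pE.
rewrite -sum1_count -[RHS]big_undup_iterop_count /=.
apply: eq_bigr => x _; rewrite mu_prod_XsubC.
by rewrite Monoid.iteropE iter_addn_0 mul1n.
Qed.

Lemma psd_degree_mx n k (H : mwgraph R n k) : psd (degree_mx H).
Proof.
have pD u : psd (gen_degree H u).
  split=> [|x].
    by rewrite /gen_degree raddf_sum; apply: eq_bigr => v _; rewrite /= trmx_mul trmxK.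
  rewrite /gen_degree mulmx_sumr mulmx_suml summxE sumr_ge0 // => v _.
  by case: (psd_gram (edge_vec H u v)) => _; apply.
split=> [|x].
  by rewrite /degree_mx tr_mxdiag; apply: eq_mxdiag => u; case: (pD u).
rewrite -[x]submxcolK tr_mxcol /degree_mx mul_mxrow_mxdiag mul_mxrow_mxcol.
by rewrite summxE sumr_ge0 // => u _; case: (pD u) => _; apply.
Qed.
End Facts.

(* Main.v *)
(** Write N = P - M with P = S D S and M = S A S, where S is the square root of
    the pseudoinverse D+ and A = D - L is the block adjacency matrix. P is
    idempotent with P N = N, so tr P = rank P is at least the number of nonzero
    eigenvalues of N and
      tr M^2 = tr P - 2 tr N + tr N^2 >= sum of (1 - r)^2 over the eigenvalues
    r <> 0 of N, in which every r in (0, zeta] contributes at least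
    (1 - zeta)^2. Conversely
      tr M^2 = tr (D+ A D+ A)
             = sum over ordered edges (u, v) of (phi^T D_u+ phi) (phi^T D_v+ phi).
    Almost regularity bounds the second factor by gamma k / n, and for fixed u
    the first factors add up to tr (D_u+ D_u) = rank D_u <= k. *)
Require Import Defs.
From mathcomp Require Import all_boot all_order all_algebra.
From mathcomp Require Import reals.
From mathcomp Require Import complex mxred spectral sesquilinear ring lra.

Set Implicit Arguments.
Unset Strict Implicit.
Unset Printing Implicit Defensive.

Import Order.TTheory GRing.Theory Num.Theory.
Local Open Scope ring_scope.

Lemma mxtrace_idem (F : fieldType) n (P : 'M[F]_n) :
  P *m P = P -> \tr P = (\rank P)%:R.
Proof.
move=> PP; have col_free : row_free (col_base P)^T.
  by rewrite /row_free mxrank_tr; exact: col_base_full.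
suff rowcol1 : row_base P *m col_base P = 1%:M.
  by rewrite -[in LHS](mulmx_base P) mxtrace_mulC rowcol1 mxtrace1.
apply: (row_free_inj (row_base_free P)); apply: trmx_inj.
apply: (row_free_inj col_free); rewrite -!trmx_mul mul1mx.
by rewrite -(mulmxA (row_base P)) (mulmxA (col_base P)) !mulmx_base PP.
Qed.

Lemma rank_diag_mx (F : fieldType) n (d : 'rV[F]_n) :
  \rank (diag_mx d) = (\sum_i (d ord0 i != 0%R))%N.
Proof.
elim: n d => [|n IHn]; first by move=> d; rewrite big_ord0 thinmx0 mxrank0.
rewrite -[n.+1]/(1 + n)%N => d; rewrite -[d]hsubmxK.
move: (lsubmx d) (rsubmx d) => x e.
rewrite diag_mx_row rank_diag_block_mx IHn big_split_ord big_ord1 row_mxEl.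
congr (_ + _)%N; last by apply: eq_bigr => i _; rewrite row_mxEr.
rewrite rank_rV; congr (nat_of_bool (~~ _)).
apply/eqP/eqP => [/matrixP/(_ ord0 ord0)|x0]; first by rewrite !mxE.
by apply/matrixP => i j; rewrite !mxE !ord1 x0 mul0rn.
Qed.

Section Similarity.
Variables (F : fieldType) (n : nat) (V : 'M[F]_n).
Hypothesis Vu : V \in unitmx.

Lemma mxtrace_conjmx (A : 'M[F]_n) : \tr (conjmx V A) = \tr A.
Proof. by rewrite conjumx // mxtrace_mulC mulKmx. Qed.

Lemma mxrank_conjmx (A : 'M[F]_n) : \rank (conjmx V A) = \rank A.
Proof.
rewrite conjumx // mxrankMfree ?row_free_unit ?unitmx_inv //.
by rewrite eqmxMfull ?row_full_unit.
Qed.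

Lemma conjumxM (A B : 'M[F]_n) :
  conjmx V (A *m B) = conjmx V A *m conjmx V B.
Proof. by rewrite conjmxM // inE stablemx_unit. Qed.

Lemma char_poly_conjmx (A : 'M[F]_n) : char_poly (conjmx V A) = char_poly A.
Proof.
rewrite /char_poly /char_poly_mx conjumx //.
pose VX := map_mx polyC V; pose WX := map_mx polyC (invmx V).
have VW : VX *m WX = 1%:M by rewrite -map_mxM mulmxV // map_mx1.
have -> : 'X%:M - map_mx polyC (V *m A *m invmx V) =
    VX *m ('X%:M - map_mx polyC A) *m WX.
  by rewrite mulmxBr mulmxBl !map_mxM scalar_mxC -(mulmxA _%:M) VW mulmx1.
by rewrite !det_mulmx mulrAC -det_mulmx VW det1 mul1r.
Qed.

End Similarity.

(* The spectral theorem of the library is over R[i]; since the spectrum is real,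
   real_similar turns the unitary change of basis into one over R. *)
Lemma symmetric_diagonalizable (R : rcfType) n (A : 'M[R]_n) :
  A^T = A -> diagonalizable A.
Proof.
move=> symA; pose toC := @real_complex R; pose AC := map_mx toC A.
have realP m p (B : 'M[R[i]]_(m, p)) :
  B \is a mxOver Num.real -> exists B' : 'M[R]_(m, p), B = map_mx toC B'.
  move=> /mxOverP realB; exists (map_mx (@complex.Re R) B).
  apply/matrixP => i j; rewrite !mxE.
  by have /complex_realP[y ->] := realB i j.
have real_map m p (B : 'M[R]_(m, p)) : map_mx toC B \is a mxOver Num.real.
  by apply/mxOverP => i j; rewrite mxE; apply/complex_realP; exists (B i j).
have hermAC : AC \is hermsymmx.
  apply: realsym_hermsym (real_map _ _ A).
  by apply/is_hermitianmxP; rewrite scale1r map_mx_id //= map_trmx symA.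
have ACE := orthomx_spectralP (hermitian_normalmx hermAC).
have [d dE] := realP _ _ _ (hermitian_spectral_diag_real hermAC).
have [] := @real_similar _ _ AC (map_mx toC (diag_mx d)).
- exists (spectralmx AC); first exact: spectral_unit.
  by apply/similarLR; rewrite ?spectral_unit // conjVmx ?spectral_unit //
    map_diag_mx -dE.
- exact: real_map.
- exact: real_map.
move=> _ /andP[/realP[U ->]]; rewrite map_unitmx => Uu simAC.
exists U => //; apply/similar_diagPex; exists d; apply/similarP => //.
apply: (@map_mx_inj _ _ toC); rewrite !map_mxM.
by apply/similarP; rewrite ?map_unitmx.
Qed.

Section EigenvalueCount.
Variables (R : realType) (n : nat).
Implicit Types (A N P : 'M[R]_n) (d : 'rV[R]_n) (zeta : R).

Lemma num_eigenvalues_in_conj_diag (V : 'M[R]_n) d (a b : R) :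
  V \in unitmx ->
  num_eigenvalues_in (conjmx V (diag_mx d)) a b =
    (\sum_i ((a < d ord0 i) && (d ord0 i <= b))%R)%N.
Proof.
move=> Vu; rewrite (num_eigenvalues_inE (s := codom (d ord0))) => [|].
  by rewrite codomE count_map -sum1_count big_enum_cond /= big_mkcond.
rewrite char_poly_conjmx // char_poly_trig ?diag_mx_is_trig //.
rewrite codomE big_map big_enum.
by apply: eq_bigr => i _; rewrite mxE eqxx.
Qed.

Lemma sum_sqr_1B_diag d :
  \sum_(i | d ord0 i != 0) (1 - d ord0 i) ^+ 2 =
    (\rank (diag_mx d))%:R - 2 * \tr (diag_mx d)
      + \tr (diag_mx d *m diag_mx d).
Proof.
rewrite rank_diag_mx natr_sum mulmx_diag !mxtrace_diag mulr_sumr -sumrB.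
rewrite -big_split big_mkcond; apply: eq_bigr => i _; rewrite mxE /=.
by case: eqVneq => [->|_] /=; ring.
Qed.

Lemma num_eigenvalues_in_le_mxtrace A zeta :
  diagonalizable A -> zeta < 1 ->
  (num_eigenvalues_in A 0 zeta)%:R * (1 - zeta) ^+ 2
    <= (\rank A)%:R - 2 * \tr A + \tr (A *m A).
Proof.
move=> [V Vu /(similar_diagLR Vu)[d ->]] zeta1.
have Wu : invmx V \in unitmx by rewrite unitmx_inv.
rewrite -conjumxM // mxrank_conjmx // !mxtrace_conjmx // -sum_sqr_1B_diag.
rewrite num_eigenvalues_in_conj_diag // natr_sum mulr_suml.
rewrite [leRHS]big_mkcond ler_sum // => i _; case: ifP => [_|/negbFE/eqP ->].
  case: andP => [[d_gt0 d_le]|_]; last by rewrite mul0r sqr_ge0.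
  by rewrite mul1r ler_sqr ?nnegrE; lra.
by rewrite ltxx mul0r.
Qed.

Lemma num_eigenvalues_in_le_mxtrace_sqr N P zeta :
  diagonalizable N -> P *m P = P -> P *m N = N -> zeta < 1 ->
  (num_eigenvalues_in N 0 zeta)%:R * (1 - zeta) ^+ 2
    <= \tr ((P - N) *m (P - N)).
Proof.
move=> diagN PP PN zeta1.
apply: le_trans (num_eigenvalues_in_le_mxtrace diagN zeta1) _.
have -> : \tr ((P - N) *m (P - N)) = \tr P - 2 * \tr N + \tr (N *m N).
  by rewrite mulmxBl !mulmxBr PP PN !linearB /= (mxtrace_mulC N P) PN; ring.
by rewrite !lerD2r (mxtrace_idem PP) ler_nat -PN mxrankM_maxl.
Qed.

End EigenvalueCount.

Section PositiveSemidefinite.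
Variable R : realType.

Lemma psd_sum n (I : Type) (r : seq I) (P : pred I) (A : I -> 'M[R]_n) :
  (forall i, P i -> psd (A i)) -> psd (\sum_(i <- r | P i) A i).
Proof.
move=> psdA; elim/big_ind: _ => // [|B C [symB B_ge0] [symC C_ge0]].
  by split=> [|x]; rewrite ?trmx0 // mulmx0 mul0mx mxE.
split=> [|x]; first by rewrite linearD /= symB symC.
by rewrite mulmxDr mulmxDl mxE addr_ge0.
Qed.

Lemma mulmx_gram_eq0 m n p (B : 'M[R]_(m, n)) (C : 'M[R]_(n, p)) :
  B^T *m B *m C = 0 -> B *m C = 0.
Proof.
move=> BBC0; apply: trmx_inj; rewrite trmx0; apply: gram_eq0.
by rewrite trmxK trmx_mul -mulmxA (mulmxA B^T) BBC0 mulmx0.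
Qed.

Lemma mxtrace_pseudoinverse_mul m n (A : 'M[R]_(m, n)) :
  \tr (pseudoinverse A *m A) = (\rank A)%:R.
Proof.
have [AXA XAX _ _] := pseudoinverseP A.
rewrite mxtrace_idem; last by rewrite mulmxA XAX.
congr _%:R; apply/eqP; rewrite eqn_leq mxrankM_maxr /=.
by rewrite -[in leqLHS]AXA -mulmxA mxrankM_maxr.
Qed.

Definition pinv_sqrt n (D : 'M[R]_n) : 'M[R]_n := psd_sqrt (pseudoinverse D).

Section PinvSqrt.
Variables (n : nat) (D : 'M[R]_n).
Hypothesis psdD : psd D.

Lemma pinv_sqrt_sym : (pinv_sqrt D)^T = pinv_sqrt D.
Proof. by case: (psd_sqrtP (psd_pseudoinverse psdD)) => -[]. Qed.

Lemma pinv_sqrt_sqr : pinv_sqrt D *m pinv_sqrt D = pseudoinverse D.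
Proof. by case: (psd_sqrtP (psd_pseudoinverse psdD)). Qed.

Lemma pinv_sqrt_conjK :
  pinv_sqrt D *m D *m pinv_sqrt D *m pinv_sqrt D = pinv_sqrt D.
Proof.
have [_ XDX _ _] := pseudoinverseP D.
have sqrtDX : pinv_sqrt D *m (D *m pseudoinverse D - 1%:M) = 0.
  apply: mulmx_gram_eq0.
  by rewrite pinv_sqrt_sym pinv_sqrt_sqr mulmxBr mulmx1 mulmxA XDX subrr.
rewrite -!mulmxA pinv_sqrt_sqr; apply: subr0_eq.
by move: sqrtDX; rewrite mulmxBr mulmx1.
Qed.

Lemma mxtrace_pinv_sqrt_conj_sqr (A : 'M[R]_n) :
  let B := pinv_sqrt D *m A *m pinv_sqrt D in
  \tr (B *m B) = \tr (pseudoinverse D *m A *m (pseudoinverse D *m A)).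
Proof.
by rewrite /= -pinv_sqrt_sqr mulmxA [LHS]mxtrace_mulC !mulmxA.
Qed.

End PinvSqrt.
End PositiveSemidefinite.

Lemma mul_mxdiag (R : pzSemiRingType) n (p_ : 'I_n -> nat)
    (B C : forall u, 'M[R]_(p_ u)) :
  \mxdiag_u B u *m \mxdiag_u C u = \mxdiag_u (B u *m C u).
Proof.
rewrite {2}/mxdiag mul_mxdiag_mxblock; apply/eq_mxblock => u v.
by case: eqVneq => [<-|_]; rewrite ?conform_mx_id ?mulmx0.
Qed.

Lemma pseudoinverse_mxdiag (R : realType) n (p_ : 'I_n -> nat)
    (B : forall u, 'M[R]_(p_ u)) :
  pseudoinverse (\mxdiag_u B u) = \mxdiag_u pseudoinverse (B u).
Proof.
apply: (is_pseudoinverse_uniq (pseudoinverseP _)).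
split; rewrite !mul_mxdiag ?tr_mxdiag; apply: eq_mxdiag => u;
  by case: (pseudoinverseP (B u)).
Qed.

Section BlockEmbedding.
Variables (R : pzRingType) (n k : nat).

Definition block_emb (u : 'I_n) : 'M[R]_(\sum_(w < n) k, k) :=
  \mxcol_(w < n) (w == u)%:R%:M.

Lemma mul_block_emb_tr u v (B : 'M[R]_k) :
  block_emb u *m B *m (block_emb v)^T =
    \mxblock_(w < n, w' < n) (B *+ ((w == u) && (w' == v))).
Proof.
rewrite /block_emb mxcol_mul tr_mxcol mul_mxcol_mxrow.
apply/eq_mxblock => w w'; rewrite tr_scalar_mx mul_scalar_mx.
case: (w == u); rewrite ?scale0r ?mul0mx // scale1r.
by case: (w' == v); rewrite ?mulmx1 // raddf0 mulmx0.
Qed.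

Lemma mxblock_sum_block_emb (B : 'I_n -> 'I_n -> 'M[R]_k) :
  \mxblock_(u < n, v < n) B u v =
    \sum_u \sum_v block_emb u *m B u v *m (block_emb v)^T.
Proof.
transitivity (\sum_u \mxblock_(w < n, w' < n)
    \sum_v B u v *+ ((w == u) && (w' == v))); last first.
  apply: eq_bigr => u _; rewrite mxblock_sum.
  by apply: eq_bigr => v _; rewrite mul_block_emb_tr.
rewrite -mxblock_sum; apply/eq_mxblock => w w'.
rewrite (bigD1 w) //= [X in _ + X]big1 => [|u /negPf uw]; last first.
  by apply: big1 => v _; rewrite eq_sym uw.
rewrite (bigD1 w') //= big1 => [|v /negPf vw]; last first.
  by rewrite (eq_sym w') vw andbF.
by rewrite !eqxx !addr0.
Qed.

Lemma mxdiag_sum_block_emb (B : 'I_n -> 'M[R]_k) :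
  \mxdiag_(u < n) B u = \sum_u block_emb u *m B u *m (block_emb u)^T.
Proof.
transitivity (\sum_u \mxblock_(w < n, w' < n)
    (B u *+ ((w == u) && (w' == u)))); last first.
  by apply: eq_bigr => u _; rewrite mul_block_emb_tr.
rewrite -mxblock_sum; apply/eq_mxblock => w w'; rewrite conform_mx_id.
rewrite (bigD1 w) //= big1 => [|u /negPf uw]; last by rewrite (eq_sym w) uw.
by rewrite eqxx addr0 (eq_sym w'); case: (w == w').
Qed.

End BlockEmbedding.

Lemma mxtrace_mul_outer (R : comPzRingType) k (X : 'M[R]_k) (f : 'cV[R]_k) :
  \tr (X *m (f *m f^T)) = (f^T *m X *m f) ord0 ord0.
Proof. by rewrite mulmxA mxtrace_mulC mulmxA trace_mx11. Qed.

Lemma mxtrace_mul_outer2 (R : comPzRingType) k (X Y : 'M[R]_k) (f : 'cV[R]_k) :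
  \tr (X *m (f *m f^T) *m (Y *m (f *m f^T))) =
    (f^T *m X *m f) ord0 ord0 * (f^T *m Y *m f) ord0 ord0.
Proof.
have -> : X *m (f *m f^T) *m (Y *m (f *m f^T)) =
    (X *m f) *m ((f^T *m Y *m f) *m f^T) by rewrite !mulmxA.
rewrite mxtrace_mulC -(mulmxA (_ *m f)) (mulmxA f^T X) trace_mx11.
by rewrite mxE big_ord1 mulrC.
Qed.

Section Graph.
Variables (R : realType) (n k : nat) (H : mwgraph R n k).

Definition edge_weight (u v : 'I_n) : 'M[R]_k :=
  if edge H u v then edge_vec H u v *m (edge_vec H u v)^T else 0.

Definition adjacency_mx : 'M[R]_(\sum_(u < n) k) :=
  \mxblock_(u < n, v < n) edge_weight u v.

Definition leverage (u v : 'I_n) : R :=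
  ((edge_vec H u v)^T *m pseudoinverse (gen_degree H u) *m edge_vec H u v)
    ord0 ord0.

Lemma edge_weight_sym u v : edge_weight u v = edge_weight v u.
Proof.
by rewrite /edge_weight edge_sym; case: ifP => // e; rewrite (edge_vec_sym e).
Qed.

Lemma gen_degreeE u : gen_degree H u = \sum_v edge_weight u v.
Proof. by rewrite /gen_degree big_mkcond. Qed.

Lemma psd_gen_degree u : psd (gen_degree H u).
Proof. by apply: psd_sum => v _; exact: psd_gram. Qed.

Lemma psd_laplacian o : psd (laplacian H o).
Proof. by do 2![apply: psd_sum => ? _]; exact: psd_gram. Qed.

Lemma normalized_laplacian_sym o :
  (normalized_laplacian H o)^T = normalized_laplacian H o.
Proof.
have [symL _] := psd_laplacian o.
by rewrite !trmx_mul symL (pinv_sqrt_sym (psd_degree_mx H)) mulmxA.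
Qed.

Lemma sum_orientation (V : nmodType) (o : rel 'I_n) (F : 'I_n -> 'I_n -> V) :
  is_orientation H o -> (forall u v, ~~ edge H u v -> F u v = 0) ->
  \sum_u \sum_(v | edge H u v && o u v) (F u v + F v u) = \sum_u \sum_v F u v.
Proof.
move=> oriented F0.
under eq_bigr => u _ do rewrite big_split /=.
rewrite big_split /= [X in _ + X](exchange_big_dep xpredT) //= -big_split /=.
apply: eq_bigr => u _; rewrite [RHS](bigID (edge H u)) /=.
rewrite [X in _ = _ + X]big1 ?addr0 => [|v /F0 //].
rewrite [RHS](bigID (o u)) /=; congr (_ + _); apply: eq_bigl => v.
rewrite edge_sym; case uv: (edge H u v) => //=.
by rewrite oriented // edge_sym.
Qed.

Lemma incidenceE u v : edge H u v ->
  incidence H u v = (block_emb R k u - block_emb R k v) *m edge_vec H u v.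
Proof.
move=> uv; have /negPf neq_uv : u != v.
  by apply: contraTneq uv => ->; rewrite edge_irr.
rewrite /block_emb -mxcolB mxcol_mul; apply/eq_mxcol => w.
rewrite mulmxBl !mul_scalar_mx; case: (eqVneq w u) => [->|_].
  by rewrite neq_uv scale1r scale0r subr0.
by case: eqVneq => _; rewrite !(scale0r, scale1r) sub0r ?oppr0.
Qed.

Lemma laplacianE o :
  is_orientation H o -> laplacian H o = degree_mx H - adjacency_mx.
Proof.
move=> oriented; pose E := @block_emb R n k.
pose F u v := E u *m edge_weight u v *m (E u)^T
              - E u *m edge_weight u v *m (E v)^T.
transitivity (\sum_u \sum_(v | edge H u v && o u v) (F u v + F v u)).
  apply: eq_bigr => u _; apply: eq_bigr => v /andP[uv _].
  rewrite incidenceE // trmx_mul mulmxA -(mulmxA (E u - E v)).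
  rewrite /F (edge_weight_sym v) /edge_weight uv.
  by rewrite linearB mulmxBl !mulmxBl !mulmxBr opprB.
rewrite sum_orientation // => [|u v /negPf uv]; last first.
  by rewrite /F /edge_weight uv mulmx0 !mul0mx subrr.
rewrite /adjacency_mx mxblock_sum_block_emb /degree_mx mxdiag_sum_block_emb.
rewrite -sumrB; apply: eq_bigr => u _.
by rewrite sumrB gen_degreeE mulmx_sumr mulmx_suml.
Qed.

Lemma leverage_ge0 u v : 0 <= leverage u v.
Proof. by have [_] := psd_pseudoinverse (psd_gen_degree u); apply. Qed.

Lemma sum_leverage u :
  \sum_(v | edge H u v) leverage u v = (\rank (gen_degree H u))%:R.
Proof.
rewrite -mxtrace_pseudoinverse_mul {2}/gen_degree mulmx_sumr linear_sum /=.
by apply: eq_bigr => v _; rewrite mxtrace_mul_outer.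
Qed.

Lemma mxtrace_pinv_adjacency_sqr :
  let B := pseudoinverse (degree_mx H) *m adjacency_mx in
  \tr (B *m B) = \sum_u \sum_(v | edge H u v) leverage u v * leverage v u.
Proof.
rewrite /= pseudoinverse_mxdiag mul_mxdiag_mxblock mul_mxblock mxtrace_mxblock.
apply: eq_bigr => u _; rewrite linear_sum [RHS]big_mkcond /=.
apply: eq_bigr => v _; rewrite (edge_weight_sym v u) /edge_weight.
case: ifP => [uv|_]; last by rewrite !mulmx0 linear0.
by rewrite mxtrace_mul_outer2 /leverage -(edge_vec_sym uv).
Qed.

Lemma mxtrace_pinv_adjacency_sqr_le (gamma : R) :
  0 <= gamma -> almost_regular H gamma ->
  let B := pseudoinverse (degree_mx H) *m adjacency_mx in
  \tr (B *m B) <= gamma * k%:R ^+ 2.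
Proof.
move=> gamma_ge0 reg; rewrite /= mxtrace_pinv_adjacency_sqr.
have vertex_le u : \sum_(v | edge H u v) leverage u v * leverage v u
    <= gamma * k%:R ^+ 2 / n%:R.
  apply: (@le_trans _ _ (k%:R * (gamma * k%:R / n%:R))); last by lra.
  apply: (@le_trans _ _ ((\rank (gen_degree H u))%:R * (gamma * k%:R / n%:R))).
    rewrite -sum_leverage mulr_suml; apply: ler_sum => v uv.
    by rewrite ler_wpM2l ?leverage_ge0 // reg // edge_sym.
  by rewrite ler_wpM2r ?ler_nat ?rank_leq_row // !mulr_ge0 ?invr_ge0 ?ler0n.
apply: le_trans (ler_sum _ (fun u _ => vertex_le u)) _.
rewrite sumr_const card_ord -[leLHS]mulr_natr.
have [->|n_gt0] := posnP n; first by rewrite mulr0 mulr_ge0 ?sqr_ge0.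
by rewrite divfK // pnatr_eq0 -lt0n.
Qed.

End Graph.

Theorem theorem3p15 (R : realType) (n k : nat) (H : mwgraph R n k)
    (o : rel 'I_n) (gamma zeta : R) :
  is_orientation H o ->
  0 <= gamma ->
  almost_regular H gamma ->
  0 < zeta -> zeta < 1 ->
  (num_eigenvalues_in (normalized_laplacian H o) 0 zeta)%:R
    <= gamma * k%:R ^+ 2 / (1 - zeta) ^+ 2.
Proof.
move=> oriented gamma_ge0 reg _ zeta1.
rewrite ler_pdivlMr ?exprn_gt0 ?subr_gt0 //.
have psdD := psd_degree_mx H; set D := degree_mx H in psdD.
set S := pinv_sqrt D; pose P := S *m D *m S.
have PS : P *m S = S := pinv_sqrt_conjK psdD.
have PP : P *m P = P by rewrite {2}/P !mulmxA PS.
have NE : normalized_laplacian H o = S *m laplacian H o *m S by [].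
have PN : P *m normalized_laplacian H o = normalized_laplacian H o.
  by rewrite NE !mulmxA PS.
have PBN : P - normalized_laplacian H o = S *m adjacency_mx H *m S.
  by rewrite NE laplacianE // mulmxBr mulmxBl subKr.
have diagN := symmetric_diagonalizable (normalized_laplacian_sym H o).
apply: le_trans (num_eigenvalues_in_le_mxtrace_sqr diagN PP PN zeta1) _.
rewrite PBN mxtrace_pinv_sqrt_conj_sqr //.
exact: mxtrace_pinv_adjacency_sqr_le.
Qed.
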